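(* Let $F$ be a field with $\operatorname{char} F\ne 2$, and let $R$ be a Rota--Baxter operator of weight zero on the Grassmann algebra $\mathrm{Gr}_2$ with linear basis $1,e_1,e_2,e_1\wedge e_2$. Then, up to conjugation by an automorphism of $\mathrm{Gr}_2$ (i.e. after replacing $R$ by $\psi^{-1}R\psi$ for some automorphism $\psi$ of the algebra $\mathrm{Gr}_2$), one has $R(1),R(e_1)\in\mathrm{span}\{e_2,e_1\wedge e_2\}$ and $R(e_2)=R(e_1\wedge e_2)=0$.
   Context: $\mathrm{Gr}_2$ is the Grassmann (exterior) algebra of the two-dimensional vector space $\mathrm{span}\{e_1,e_2\}$ over $F$. A linear operator $R\colon A\to A$ on an algebra $A$ is a Rota--Baxter operator of weight zero if $R(x)R(y)=R(R(x)y+xR(y))$ for all $x,y\in A$. *)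

(* Defs.v *)
From HB Require Import structures.
From mathcomp Require Import all_boot all_algebra falgebra.

Set Implicit Arguments.
Unset Strict Implicit.
Unset Printing Implicit Defensive.

Import GRing.Theory.
Local Open Scope ring_scope.

(* The Grassmann algebra of span{e_0, ..., e_(n-1)}: an element is the family
   of its coefficients on the basis of exterior monomials e_S, where e_S is
   the exterior product, in increasing order, of the e_i with i in S. *)
Definition grassmann (F : fieldType) (n : nat) : Type := {ffun {set 'I_n} -> F}.

Section Grassmann.
Variables (F : fieldType) (n : nat).
Local Notation Gr := (grassmann F n).
Implicit Types (S T U V W : {set 'I_n}) (x y z : Gr).

HB.instance Definition _ :=
  Vector.copy Gr {ffun {set 'I_n} -> (F^o : vectType F)}.

Definition inversions S T : nat := \sum_(i in S) \sum_(j in T) (j < i)%N.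

(* For disjoint S and T, e_S /\ e_T = (-1)^(inversions S T) e_(S :|: T), and
   the product is zero otherwise; hence the coefficient of x /\ y on e_U only
   involves the splittings of U into S and U :\: S. *)
Definition wedge x y : Gr :=
  [ffun U : {set 'I_n} => \sum_(S : {set 'I_n} | S \subset U)
     (-1) ^+ inversions S (U :\: S) * (x S * y (U :\: S))].

Definition monomial S : Gr := [ffun T : {set 'I_n} => (T == S)%:R].

Lemma inversionsUl S T V : [disjoint S & T] ->
  inversions (S :|: T) V = (inversions S V + inversions T V)%N.
Proof.
by move=> dST; rewrite /inversions -bigU //; apply: eq_bigl => i; rewrite !inE.
Qed.

Lemma inversionsUr S T V : [disjoint T & V] ->
  inversions S (T :|: V) = (inversions S T + inversions S V)%N.
Proof.
move=> dTV; rewrite /inversions -big_split /=; apply: eq_bigr => i _.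
by rewrite -bigU //; apply: eq_bigl => j; rewrite !inE.
Qed.

Lemma inversions0l T : inversions set0 T = 0%N.
Proof. by rewrite /inversions big_set0. Qed.

Lemma inversions0r S : inversions S set0 = 0%N.
Proof. by rewrite /inversions big1 // => i _; rewrite big_set0. Qed.

Lemma wedgeA : associative wedge.
Proof.
move=> x y z; apply/ffunP=> U; rewrite !ffunE.
pose G S T : F := (-1) ^+ (inversions S (T :\: S) + inversions T (U :\: T)) *
  (x S * y (T :\: S) * z (U :\: T)).
transitivity (\sum_(S : {set 'I_n} | S \subset U)
    \sum_(T : {set 'I_n} | (S \subset T) && (T \subset U))
      G S T); last first.
  rewrite (exchange_big_dep (fun T : {set 'I_n} => T \subset U)) /=; last first.
    by move=> S T _ /andP[].
  apply: eq_bigr => T sTU; rewrite ffunE mulr_suml mulr_sumr.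
  apply: eq_big => [S | S /andP[_ /andP[sST _]]].
    by rewrite sTU andbT; apply: andb_idl => sST; apply: subset_trans sTU.
  by rewrite /G exprD -!mulrA mulrCA.
apply: eq_bigr => S sSU; rewrite ffunE !mulr_sumr.
rewrite [RHS](reindex_onto (fun W => S :|: W) (fun T => T :\: S)) /=; last first.
  by move=> T /andP[sST _]; rewrite -[RHS](setID T S) (setIidPr sST).
apply: eq_big => [W | W].
  rewrite subsetUl subUset sSU /= setDUl setDv set0U subsetD.
  by congr (_ && _); apply/setDidPl/eqP.
rewrite subsetD => /andP[sWU dWS].
have dSW: [disjoint S & W] by rewrite disjoint_sym.
have eW: (S :|: W) :\: S = W.
  by rewrite setDUl setDv set0U; apply/setDidPl.
have eU: U :\: (S :|: W) = (U :\: S) :\: W by rewrite setDDl.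
have sW : W \subset U :\: S by rewrite subsetD sWU.
have eUS : U :\: S = W :|: (U :\: S) :\: W.
  by rewrite -[LHS](setID _ W) (setIidPr sW).
have dd: [disjoint W & (U :\: S) :\: W].
  by rewrite disjoint_sym -setI_eq0 setIDAC -setIDA setDv setI0.
rewrite /G eW eU (inversionsUl _ dSW) {1}eUS (inversionsUr _ dd) !exprD.
by rewrite -!mulrA; congr (_ * _); rewrite ![x S * _]mulrCA.
Qed.

Lemma wedge1l : left_id (monomial set0) wedge.
Proof.
move=> x; apply/ffunP=> U; rewrite ffunE (bigD1 set0) ?sub0set //= big1.
  by rewrite setD0 inversions0l ffunE eqxx !mul1r addr0.
by move=> S /andP[_ /negPf S0]; rewrite ffunE S0 mul0r mulr0.
Qed.

Lemma wedge1r : right_id (monomial set0) wedge.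
Proof.
move=> x; apply/ffunP=> U; rewrite ffunE (bigD1 U) //= big1.
  by rewrite setDv inversions0r ffunE eqxx mul1r mulr1 addr0.
move=> S /andP[sSU neSU]; rewrite ffunE setD_eq0.
have [sUS|_] := boolP (U \subset S); last by rewrite !mulr0.
by rewrite eqEsubset sSU sUS in neSU.
Qed.

Lemma wedgeDl : left_distributive wedge +%R.
Proof.
move=> x y z; apply/ffunP=> U; rewrite !ffunE -big_split /=.
by apply: eq_bigr => S _; rewrite ffunE mulrDl mulrDr.
Qed.

Lemma wedgeDr : right_distributive wedge +%R.
Proof.
move=> x y z; apply/ffunP=> U; rewrite !ffunE -big_split /=.
by apply: eq_bigr => S _; rewrite ffunE !mulrDr.
Qed.

Lemma monomial0_neq0 : monomial set0 != 0.
Proof.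
by apply/eqP=> /ffunP/(_ set0)/eqP; rewrite !ffunE eqxx oner_eq0.
Qed.

HB.instance Definition _ := GRing.Zmodule_isNzRing.Build Gr
  wedgeA wedge1l wedge1r wedgeDl wedgeDr monomial0_neq0.

Lemma coefZ (a : F) x S : (a *: x) S = a * x S.
Proof. by rewrite ffunE. Qed.

Lemma wedgeZl (a : F) x y : a *: (x * y) = (a *: x) * y.
Proof.
apply/ffunP=> U; rewrite coefZ !ffunE mulr_sumr.
by apply: eq_bigr => S _; rewrite coefZ mulrCA !mulrA.
Qed.

Lemma wedgeZr (a : F) x y : a *: (x * y) = x * (a *: y).
Proof.
apply/ffunP=> U; rewrite coefZ !ffunE mulr_sumr.
by apply: eq_bigr => S _; rewrite coefZ mulrCA [x S * (a * _)]mulrCA.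
Qed.

HB.instance Definition _ := GRing.Lmodule_isLalgebra.Build F Gr wedgeZl.
HB.instance Definition _ := GRing.Lalgebra_isAlgebra.Build F Gr wedgeZr.
HB.instance Definition _ := Algebra_isFalgebra.Build F Gr.

Definition gen (i : 'I_n) : Gr := monomial [set i].

Lemma monomialM S T :
  monomial S * monomial T =
  if [disjoint S & T] then (-1) ^+ inversions S T *: monomial (S :|: T) else 0.
Proof.
apply/ffunP=> U; rewrite ffunE.
rewrite (eq_bigr (fun S' : {set 'I_n} => if S' == S then
  (-1) ^+ inversions S (U :\: S) * (U :\: S == T)%:R else 0)); last first.
  by move=> S' _; rewrite !ffunE; case: eqP => [->|_]; rewrite ?mul1r // mul0r mulr0.
rewrite -big_mkcondr /= (eq_bigl (fun S' => (S \subset U) && (S' == S))); last first.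
  by move=> S'; case: eqP => [->|_]; rewrite ?andbF.
have [sSU|nSU] := boolP (S \subset U); last first.
  rewrite big_pred0 //; case: ifP => _; rewrite !ffunE //.
  case: eqP => [eU|_]; last by rewrite scaler0.
  by rewrite eU subsetUl in nSU.
rewrite big_pred1_eq; have [eT|neT] := eqVneq (U :\: S) T.
  have dST: [disjoint S & T].
    by rewrite -eT disjoint_sym -setI_eq0 setIDAC -setIDA setDv setI0.
  have eU: U = S :|: T by rewrite -eT -[LHS](setID U S) (setIidPr sSU).
  by rewrite dST !ffunE eT -eU eqxx.
rewrite mulr0; case: ifP => [dST|_]; rewrite !ffunE //.
case: eqP => [eU|_]; last by rewrite scaler0.
case/eqP: neT; rewrite eU setDUl setDv set0U; apply/setDidPl.
by rewrite disjoint_sym.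
Qed.

Lemma gen_sqr i : gen i * gen i = 0.
Proof. by rewrite monomialM disjoints1 inE eqxx. Qed.

Lemma gen_anticomm i j : gen i * gen j = - (gen j * gen i).
Proof.
have [->|neij] := eqVneq i j; first by rewrite gen_sqr oppr0.
rewrite !monomialM !disjoints1 !inE neij eq_sym neij setUC -scaleNr.
rewrite /inversions !big_set1.
rewrite -(inj_eq val_inj) in neij.
by case: ltngtP neij => // _ _; rewrite ?expr0 ?expr1 ?opprK.
Qed.

Lemma grassmann_sum x : x = \sum_S x S *: monomial S.
Proof.
apply/ffunP=> U; rewrite sum_ffunE (bigD1 U) //= big1 => [|S neSU].
  by rewrite coefZ ffunE eqxx mulr1 addr0.
by rewrite coefZ ffunE eq_sym (negPf neSU) mulr0.
Qed.

End Grassmann.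

(* The basis vectors e_1 and e_2 of the plane are gen 0 and gen 1. *)
Definition e1 {F : fieldType} : grassmann F 2 := gen F (ord0 : 'I_2).
Definition e2 {F : fieldType} : grassmann F 2 := gen F (ord_max : 'I_2).

Lemma set_ord2 (S : {set 'I_2}) :
  S \in [:: set0; [set ord0]; [set ord_max]; [set: 'I_2]].
Proof.
have eqS (T : {set 'I_2}) : (ord0 \in S) = (ord0 \in T) ->
    (ord_max \in S) = (ord_max \in T) -> S = T.
  move=> eq0 eq1; apply/setP=> i; case: (unliftP ord0 i) => [j|] -> //.
  by rewrite (ord1 j) (_ : lift _ _ = ord_max) //; apply: val_inj.
rewrite !inE; case S0: (ord0 \in S); case S1: (ord_max \in S).
- by rewrite [S in _ || (_ || (_ || (S == _)))](eqS setT) ?inE ?eqxx ?orbT.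
- by rewrite (eqS [set ord0]) ?inE ?eqxx ?orbT.
- by rewrite (eqS [set ord_max]) ?inE ?eqxx ?orbT.
- by rewrite (eqS set0) ?inE ?eqxx.
Qed.

Lemma e1Me2 (F : fieldType) : e1 * e2 = monomial F [set: 'I_2].
Proof.
rewrite monomialM disjoints1 inE /inversions !big_set1 /= scale1r.
by congr monomial; have:= set_ord2 ([set ord0] :|: [set ord_max]);
   rewrite !inE => /or4P[] /eqP // /setP E;
   move: (E ord0) (E ord_max); rewrite !inE.
Qed.

Lemma Gr2_basis (F : fieldType) :
  basis_of {: grassmann F 2} [:: 1; e1; e2; e1 * e2].
Proof.
have dimG : dim (grassmann F 2) = 4%N.
  rewrite -[LHS]/(#|{set 'I_2}| * 1)%N muln1.
  by rewrite -cardsT -powersetT card_powerset cardsT card_ord.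
rewrite basisEdim dimvf dimG andbT.
apply/subvP=> x _; rewrite [x]grassmann_sum memv_suml // => S _.
apply/memvZ/memv_span; rewrite e1Me2.
have:= set_ord2 S; rewrite !inE.
by case/or4P=> /eqP ->; rewrite eqxx ?orbT.
Qed.

Definition rota_baxter0 (F : fieldType) (A : falgType F) (R : 'End(A)) : Prop :=
  forall x y : A, R x * R y = R (R x * y + x * R y).

(* Main.v *)
Require Import Defs.
From mathcomp Require Import all_boot all_algebra falgebra ring.
Import GRing.Theory.
Local Open Scope ring_scope.

(* Write w = e1 /\ e2 and N = span{e1, e2, w}; elements of N square to zero and
   anticommute. The image of R is a subalgebra without 1, since R x = 1 would
   give 1 = R (2 x) = 2; so it has no invertible element and lies in N.
   Comparing R x * R w = R (x * R w) for x = e1, e2 and for x = 1 gives R w = 0.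
   Then R (1)^2 = 2 R (R 1) yields R (R 1) = 0, and
   R 1 * R x = R (R x) = R x * R 1 yields R (R x) = 0 by anticommutativity,
   whence R x * R y = 0 for all x and y. So the image of R lies in span{v, w}
   for a single nonzero v in span{e1, e2} with R v = 0, and an automorphism
   sending e2 to v and fixing w normalizes R. *)

(** Coordinates reduce each identity in the algebra to four [ring] goals over F. *)
Definition gr2 {F : fieldType} (a b c d : F) : grassmann F 2 :=
  a *: 1 + b *: e1 + c *: e2 + d *: (e1 * e2).

(** * Arithmetic in coordinates *)

Section Coordinates.
Context {F : fieldType}.
Implicit Types (a b c d k : F) (x y : grassmann F 2).

Lemma congr_gr2 a b c d a' b' c' d' :
  a = a' -> b = b' -> c = c' -> d = d' -> gr2 a b c d = gr2 a' b' c' d'.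
Proof. by do 4!move=> ->. Qed.

Lemma gr2_1 : gr2 1 0 0 0 = 1 :> grassmann F 2.
Proof. by rewrite /gr2 scale1r !scale0r !addr0. Qed.

Lemma gr2_e2 : gr2 0 0 1 0 = e2 :> grassmann F 2.
Proof. by rewrite /gr2 scale1r !scale0r !add0r !addr0. Qed.

Lemma gr2_e12 : gr2 0 0 0 1 = e1 * e2 :> grassmann F 2.
Proof. by rewrite /gr2 scale1r !scale0r !add0r. Qed.

Lemma gr2_0 : gr2 0 0 0 0 = 0 :> grassmann F 2.
Proof. by rewrite /gr2 !scale0r !add0r. Qed.

Lemma gr2D a b c d a' b' c' d' :
  gr2 a b c d + gr2 a' b' c' d' = gr2 (a + a') (b + b') (c + c') (d + d').
Proof.
by rewrite addrACA [X in X + _]addrACA [X in X + _ + _]addrACA -!scalerDl.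
Qed.

Lemma gr2Z k a b c d : k *: gr2 a b c d = gr2 (k * a) (k * b) (k * c) (k * d).
Proof. by rewrite !scalerDr !scalerA. Qed.

Lemma gr2M a b c d a' b' c' d' :
  gr2 a b c d * gr2 a' b' c' d' =
  gr2 (a * a') (a * b' + b * a') (a * c' + c * a')
      (a * d' + d * a' + (b * c' - c * b')).
Proof.
have sq1 : e1 * e1 = 0 :> grassmann F 2 by apply: gen_sqr.
have sq2 : e2 * e2 = 0 :> grassmann F 2 by apply: gen_sqr.
have e21 : e2 * e1 = - (e1 * e2) :> grassmann F 2 by apply: gen_anticomm.
have e1_12 : e1 * (e1 * e2) = 0 :> grassmann F 2 by rewrite mulrA sq1 mul0r.
have e12_2 : e1 * e2 * e2 = 0 :> grassmann F 2 by rewrite -mulrA sq2 mulr0.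
have e2_12 : e2 * (e1 * e2) = 0 :> grassmann F 2.
  by rewrite mulrA e21 mulNr e12_2 oppr0.
have e12_1 : e1 * e2 * e1 = 0 :> grassmann F 2.
  by rewrite -mulrA e21 mulrN e1_12 oppr0.
have e12_12 : e1 * e2 * (e1 * e2) = 0 :> grassmann F 2.
  by rewrite mulrA e12_1 mul0r.
rewrite /gr2 !mulrDl !mulrDr -!scalerAl -!scalerAr !mulr1 !mul1r.
rewrite sq1 sq2 e21 e1_12 e12_2 e2_12 e12_1 e12_12.
(* The product is made opaque so that [ffunE] does not expand its coefficients. *)
move: (e1 * e2) => w.
have scaleE k (t : F^o) : k *: t = k * t by [].
by apply/ffunP => U; rewrite !ffunE !scaleE; ring.
Qed.

Lemma gr2P x : exists a b c d, x = gr2 a b c d.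
Proof.
have /coord_basis/(_ (memvf x)) -> := Gr2_basis F.
rewrite !big_ord_recr big_ord0 /= add0r.
by do 4!eexists; reflexivity.
Qed.

Lemma gr2_eq0 a b c d : gr2 a b c d = 0 -> [/\ a = 0, b = 0, c = 0 & d = 0].
Proof.
have /basis_free/freeP free4 := Gr2_basis F => eq0.
have := free4 (fun i : 'I_4 => [:: a; b; c; d]`_i).
rewrite !big_ord_recr big_ord0 /= add0r => /(_ eq0) z.
by split; [apply: (z 0) | apply: (z 1) | apply: (z 2%:R) | apply: (z 3%:R)].
Qed.

Lemma gr2_inj a b c d a' b' c' d' :
  gr2 a b c d = gr2 a' b' c' d' -> [/\ a = a', b = b', c = c' & d = d'].
Proof.
move/eqP; rewrite -subr_eq0 -scaleN1r gr2Z gr2D !mulN1r.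
by move/eqP/gr2_eq0 => [] /subr0_eq-> /subr0_eq-> /subr0_eq-> /subr0_eq->.
Qed.

Lemma e12_neq0 : e1 * e2 != 0 :> grassmann F 2.
Proof.
by rewrite -gr2_e12; apply/eqP => /gr2_eq0[_ _ _ /eqP]; rewrite oner_eq0.
Qed.

Lemma gr2_span c d : gr2 0 0 c d \in span [:: e2; e1 * e2].
Proof.
rewrite /gr2 !scale0r !add0r.
by rewrite memvD // memvZ // memv_span // !inE eqxx ?orbT.
Qed.

End Coordinates.

(** A linear map of the plane multiplies w by its determinant, so determinant 1 makes its extension
    fixing 1 and w multiplicative. *)
Lemma gr2_aut {F : fieldType} {p q b c : F} : p * c - q * b = 1 ->
  exists2 psi : 'AEnd(grassmann F 2), bijective psi &
    forall a s t d,
      psi (gr2 a s t d) = gr2 a (s * p + t * b) (s * q + t * c) d.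
Proof.
move=> det1; have pc : p * c = 1 + q * b by rewrite -det1 subrK.
have ex_lin p' q' b' c' : {f : 'End(grassmann F 2) |
    forall a s t d, f (gr2 a s t d) =
      gr2 a (s * p' + t * b') (s * q' + t * c') d}.
  have [f] := linear_of_free [:: 1; e1; e2; e1 * e2]
    [:: gr2 1 0 0 0; gr2 0 p' q' 0; gr2 0 b' c' 0; gr2 0 0 0 1].
  move=> /(_ (basis_free (Gr2_basis F)) erefl) [f1 fe1 fe2 fe12].
  exists (linfun f) => a s t d.
  rewrite lfunE /gr2 !linearD !linearZ /= f1 fe1 fe2 fe12 !gr2Z !gr2D.
  by apply: congr_gr2; ring.
(* The inverse [g] comes from the adjugate matrix. *)
have [f fE] := ex_lin p q b c; have [g gE] := ex_lin c (- q) (- b) p.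
have f_ahom : ahom_in {:grassmann F 2} f.
  apply/ahom_inP; split=> [x y _ _|]; last first.
    by rewrite -gr2_1 fE; apply: congr_gr2; ring.
  have [a [s [t [d ->]]]] := gr2P x; have [a' [s' [t' [d' ->]]]] := gr2P y.
  rewrite gr2M !fE gr2M; apply: congr_gr2; try ring.
  by ring: pc.
exists (AHom f_ahom) => //=; exists g => x;
  have [a [s [t [d ->]]]] := gr2P x;
  by rewrite (fE, gE) (fE, gE); apply: congr_gr2; ring: pc.
Qed.

(** * Image and kernel of a Rota-Baxter operator *)

Section RotaBaxter.
Context {F : fieldType} {R : 'End(grassmann F 2)}.
Hypotheses (charF : 2%N \notin [pchar F]) (RB : rota_baxter0 R).

Lemma rb_neq1 x : R x <> 1.
Proof.
move=> Rx1; have := RB x x; rewrite Rx1 !(mulr1, mul1r) linearD /= Rx1 => /eqP.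
by rewrite -{1}[1]addr0 (inj_eq (addrI _)) eq_sym oner_eq0.
Qed.

Lemma rb_nilpotent x : exists b c d, R x = gr2 0 b c d.
Proof.
have [a [b [c [d Rx]]]] := gr2P (R x); exists b, c, d.
rewrite Rx; apply: congr_gr2 => //.
apply/eqP/negPn/negP => a_neq0.
(* u = R x satisfies u^2 - 2 a u + a^2 = 0, and u^2 is again in the image. *)
apply: (@rb_neq1 (a ^- 2 *: ((a + a) *: x - (R x * x + x * R x)))).
rewrite linearZ linearB linearZ /= -RB Rx -scaleN1r gr2M !gr2Z gr2D gr2Z -gr2_1.
by apply: congr_gr2; field.
Qed.

Lemma rb_e12 : R (e1 * e2) = 0.
Proof.
have [b [c [d Rw]]] := rb_nilpotent (e1 * e2).
(* For y = p e1 + q e2, R y * w = 0 and y * R w = (pc - qb) w, so R y * R w = (pc - qb) R w. The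
   left side is a multiple of w. *)
have key p q : (p * c - q * b) * b = 0 /\ (p * c - q * b) * c = 0.
  have [b' [c' [d' Ry]]] := rb_nilpotent (gr2 0 p q 0).
  have := RB (gr2 0 p q 0) (e1 * e2).
  have -> : R (gr2 0 p q 0) * (e1 * e2) + gr2 0 p q 0 * R (e1 * e2)
      = (p * c - q * b) *: (e1 * e2).
    rewrite Ry Rw -gr2_e12 !gr2M gr2D gr2Z.
    by apply: congr_gr2; ring.
  rewrite linearZ /= Ry Rw gr2M gr2Z => /gr2_inj[_ eb ec _].
  by rewrite -eb -ec; split; ring.
have b0 : b = 0.
  have [/eqP + _] := key 0 1.
  by rewrite mul0r mul1r sub0r mulf_eq0 oppr_eq0 orbb => /eqP.
have c0 : c = 0.
  have [_ /eqP] := key 1 0.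
  by rewrite mul0r mul1r subr0 mulf_eq0 orbb => /eqP.
have Rwd : R (e1 * e2) = d *: (e1 * e2).
  by rewrite Rw b0 c0 -gr2_e12 gr2Z; apply: congr_gr2; ring.
have R1_e12 : R 1 * (e1 * e2) = 0.
  have [b' [c' [d' R1]]] := rb_nilpotent 1.
  by rewrite R1 -gr2_e12 gr2M -gr2_0; apply: congr_gr2; ring.
(* As R w = d w and R 1 * w = 0, the identity at 1 and w becomes 0 = d^2 w. *)
have := RB 1 (e1 * e2).
rewrite mul1r Rwd -scalerAr R1_e12 scaler0 add0r linearZ /= Rwd scalerA.
move=> /esym/eqP; rewrite scaler_eq0 (negPf e12_neq0) orbF mulf_eq0 orbb.
by move=> /eqP ->; rewrite scale0r.
Qed.

Lemma nilpotent_anticomm (b c d b' c' d' : F) :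
  gr2 0 b c d * gr2 0 b' c' d' = - (gr2 0 b' c' d' * gr2 0 b c d).
Proof. by rewrite !gr2M -scaleN1r gr2Z; apply: congr_gr2; ring. Qed.

(** The assumption on the characteristic enters here. *)
Lemma double_eq0 (x : grassmann F 2) : x + x = 0 -> x = 0.
Proof.
move/eqP; rewrite -[x + x]/(x *+ 2) -scaler_nat scaler_eq0 => /orP[two0|/eqP//].
by case/negP: charF; rewrite inE /= two0.
Qed.

Lemma rb_sq1 : R (R 1) = 0.
Proof.
have [b [c [d R1]]] := rb_nilpotent 1.
have RR : R 1 * R 1 = R (R 1) + R (R 1) by rewrite RB mulr1 mul1r linearD.
by apply: double_eq0; rewrite -RR R1 gr2M -gr2_0; apply: congr_gr2; ring.
Qed.

(** With a the constant coefficient of y, both products differ from a R x by multiples of w, which R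
    kills. *)
Lemma rb_mulR x y :
  exists a, R (R x * y) = a *: R (R x) /\ R (y * R x) = a *: R (R x).
Proof.
have [b [c [d ->]]] := rb_nilpotent x; have [a [s [t [e ->]]]] := gr2P y.
have Rw k : R (k *: (e1 * e2)) = 0 by rewrite linearZ /= rb_e12 scaler0.
exists a; rewrite -linearZ /=; split; apply/eqP; rewrite -subr_eq0 -linearB /=.
  rewrite -(Rw (b * t - c * s)); apply/eqP; congr (R _).
  by rewrite -scaleN1r -gr2_e12 gr2M !gr2Z gr2D; apply: congr_gr2; ring.
rewrite -(Rw (c * s - b * t)); apply/eqP; congr (R _).
by rewrite -scaleN1r -gr2_e12 gr2M !gr2Z gr2D; apply: congr_gr2; ring.
Qed.

Lemma rb_sq x : R (R x) = 0.
Proof.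
(* Since R (R 1) = 0, both R (R 1 * x) and R (x * R 1) vanish. *)
have [a [RR1x RxR1]] := rb_mulR 1 x.
rewrite rb_sq1 scaler0 in RR1x RxR1.
have := RB 1 x; have := RB x 1.
rewrite mulr1 mul1r !linearD /= RR1x RxR1 add0r addr0 => <-.
have [b [c [d Rx]]] := rb_nilpotent x; have [b' [c' [d' R1]]] := rb_nilpotent 1.
rewrite Rx R1 nilpotent_anticomm => eqN; apply: double_eq0.
by rewrite -{1}eqN addNr.
Qed.

Lemma rb_mul0 x y : R x * R y = 0.
Proof.
have [a [+ _]] := rb_mulR x y; have [b [_ +]] := rb_mulR y x.
by rewrite RB linearD /= !rb_sq !scaler0 => -> ->; rewrite addr0.
Qed.

(** This finds v; the condition R x * v = 0 says that the planar part of R x is parallel to v. *)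
Lemma rb_kernel_vector : exists b c, [/\ (b != 0) || (c != 0),
  R (gr2 0 b c 0) = 0 & forall x, R x * gr2 0 b c 0 = 0].
Proof.
have [/subvP sub | /subvPn[w]] := boolP (limg R <= <[e1 * e2]>)%VS.
  have Rw x : exists k, R x = gr2 0 0 0 k.
    have /vlineP[k ->] := sub _ (memv_img R (memvf x)).
    by exists k; rewrite -gr2_e12 gr2Z; apply: congr_gr2; ring.
  (* R maps the plane into a line, so it has a nonzero kernel vector there. *)
  have ex_ker : exists b c : F, (b != 0) || (c != 0) /\ R (gr2 0 b c 0) = 0.
    have [k1 R1] := Rw e1; have [k2 R2] := Rw e2.
    have [k2_0|k2_neq0] := eqVneq k2 0.
      by exists 0, 1; rewrite oner_eq0 orbT gr2_e2 R2 k2_0 gr2_0.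
    exists k2, (- k1); split; first by rewrite k2_neq0.
    have -> : gr2 0 k2 (- k1) 0 = k2 *: e1 - k1 *: e2.
      by rewrite /gr2 !scale0r add0r addr0 scaleNr.
    rewrite linearB !linearZ /= R1 R2 -scaleN1r !gr2Z gr2D -gr2_0.
    by apply: congr_gr2; ring.
  have [b [c [nz Rbc]]] := ex_ker; exists b, c; split=> // x.
  by have [k ->] := Rw x; rewrite gr2M -gr2_0; apply: congr_gr2; ring.
(* Some R x is not a multiple of w; v is its planar part. *)
case/memv_imgP=> x _ ->; have [b [c [d Rx]]] := rb_nilpotent x => notw.
have vE : gr2 0 b c 0 = R x - d *: (e1 * e2).
  by rewrite Rx -gr2_e12 -scaleN1r !gr2Z gr2D; apply: congr_gr2; ring.
exists b, c; split=> [||y].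
- apply: contraNT notw; rewrite negb_or !negbK => /andP[/eqP b0 /eqP c0].
  by apply/vlineP; exists d; apply/eqP; rewrite -subr_eq0 -vE b0 c0 gr2_0.
- by rewrite vE linearB linearZ /= rb_sq rb_e12 scaler0 subr0.
- rewrite vE mulrBr rb_mul0; have [b' [c' [d' ->]]] := rb_nilpotent y.
  rewrite sub0r -gr2_e12 gr2Z gr2M -gr2_0 -scaleN1r gr2Z.
  by apply: congr_gr2; ring.
Qed.

End RotaBaxter.

(** * Conjugation to the normal form *)

Theorem proposition1 (F : fieldType) (charF : 2%N \notin [pchar F])
    (R : 'End(grassmann F 2)) (RB : rota_baxter0 R) :
  exists2 psi : 'AEnd(grassmann F 2), bijective psi &
    let R' := (psi^-1 \o R \o psi)%VF in
    [/\ R' 1 \in span [:: e2; e1 * e2],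
        R' e1 \in span [:: e2; e1 * e2],
        R' e2 = 0
      & R' (e1 * e2) = 0].
Proof.
have [b [c [nz Rv0 mulRv]]] := rb_kernel_vector charF RB.
(* Complete v to a basis of determinant 1, so that [psi] fixes w. *)
have [p [q det1]] : exists p q, p * c - q * b = 1.
  have [c0|c_neq0] := eqVneq c 0; last first.
    by exists c^-1, 0; rewrite mulVf // mul0r subr0.
  move: nz; rewrite c0 eqxx orbF => b_neq0.
  by exists 0, (- b^-1); rewrite mul0r mulNr opprK add0r mulVf.
have [psi psi_bij psiE] := gr2_aut det1; exists psi => // R'.
have psiK : cancel psi (psi^-1)%VF by apply/lker0_lfunK/lker0P/bij_inj.
have psi_e2 : psi e2 = gr2 0 b c 0.
  by rewrite -gr2_e2 psiE; apply: congr_gr2; ring.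
have psi_e12 : psi (e1 * e2) = e1 * e2.
  by rewrite -gr2_e12 psiE; apply: congr_gr2; ring.
have R'_span x : R' x \in span [:: e2; e1 * e2].
  have [s [t [d Rx]]] := rb_nilpotent RB (psi x).
  have := mulRv (psi x); rewrite Rx gr2M => /gr2_eq0[_ _ _ sc_tb].
  have tb : t * b = s * c.
    by apply/esym/eqP; rewrite -subr_eq0 -sc_tb; apply/eqP; ring.
  rewrite !comp_lfunE Rx.
  (* If (s, t) = k (b, c), then pt - qs = k (pc - qb) = k. *)
  suff -> : gr2 0 s t d = psi (gr2 0 0 (p * t - q * s) d).
    by rewrite psiK gr2_span.
  have pc : p * c = 1 + q * b by rewrite -det1 subrK.
  by rewrite psiE; apply: congr_gr2; ring: pc tb.
split=> //.
- by rewrite !comp_lfunE psi_e2 Rv0 linear0.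
- by rewrite !comp_lfunE psi_e12 (rb_e12 RB) linear0.
Qed.
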